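(* For all $n,\ell\in\mathbb{N}$ (i.e. $n,\ell\geqslant 1$), $$|\mathcal{A}_{n,\ell}|=|\mathcal{G}_{n-1,\ell}|\qquad\text{and}\qquad |\mathcal{A}^s_{n,\ell}|=|\mathcal{H}_{n-1,\ell}|.$$
   Context: For $\ell\geqslant 0$, a finite set $A\subset\mathbb{N}=\{1,2,\ldots\}$ is $\ell$-strong Schreier if $A=\emptyset$ or $\min A\geqslant \ell|A|-\ell+1$. A set $A=\{a_1<\cdots<a_n\}\subset\mathbb{N}$ is sparse if $|A|\leqslant 2$, or $|A|\geqslant 3$ and $a_i-a_{i-1}\geqslant a_{i-1}-a_{i-2}$ for $3\leqslant i\leqslant n$; it is strongly sparse if $|A|\leqslant 2$, or $|A|\geqslant 3$ and $a_i-a_{i-1}> a_{i-1}-a_{i-2}$ for $3\leqslant i\leqslant n$. $\mathcal{A}_{n,\ell}=\{A\subset\{1,\ldots,n\}: n\in A,\ A \text{ sparse and } \ell\text{-strong Schreier}\}$, $\mathcal{A}^s_{n,\ell}=\{A\subset\{1,\ldots,n\}: n\in A,\ A \text{ strongly sparse and } \ell\text{-strong Schreier}\}$. $\mathcal{G}_{n,\ell}$ is the set of partitions of $n$ having no part in $\{2,\ldots,\ell\}$; $\mathcal{H}_{n,\ell}$ is the set of partitions of $n$ having no part in $\{2,\ldots,\ell\}$ and no even part greater than $2\ell$ (when $\ell\leqslant 1$, $\{2,\ldots,\ell\}=\emptyset$). By convention $|\mathcal{G}_{0,\ell}|=|\mathcal{H}_{0,\ell}|=1$. *)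

(* Defs.v *)
From mathcomp Require Import all_boot.

Set Implicit Arguments.
Unset Strict Implicit.
Unset Printing Implicit Defensive.

(* Finite subsets of {0, ..., m-1}; [elems A] lists a_1 < ... < a_k, since
   [enum] follows the order of 'I_m (see [sorted_elems]). *)
Definition elems m (A : {set 'I_m}) : seq nat := [seq val a | a <- enum A].

Lemma mem_elems m (A : {set 'I_m}) (a : 'I_m) : (val a \in elems A) = (a \in A).
Proof. by rewrite mem_map ?mem_enum //; exact: val_inj. Qed.

Lemma sorted_elems m (A : {set 'I_m}) : sorted ltn (elems A).
Proof.
rewrite /elems sorted_map /enum_mem.
apply: sorted_filter; first by move=> y x z /=; exact: ltn_trans.
by rewrite -enumT -sorted_map val_enum_ord iota_ltn_sorted.
Qed.

Definition set_min m (A : {set 'I_m}) : nat := head 0 (elems A).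

Lemma set_minP m (A : {set 'I_m}) (a : 'I_m) : a \in A -> set_min A <= a.
Proof.
rewrite -mem_elems /set_min; case: (elems A) (sorted_elems A) => //= x s.
rewrite (path_sortedE ltn_trans) inE => /andP[/allP min_x _].
by case/predU1P=> [-> //|/min_x/ltnW].
Qed.

(* For nonempty A the truncated subtraction is the integer one. *)
Definition strong_schreier (l m : nat) (A : {set 'I_m}) : bool :=
  (A == set0) || (l * #|A| - l + 1 <= set_min A).

(* Indices are 0-based: [gap s i] is the difference of the entries of ranks
   i + 1 and i, so 2 <= i below is 3 <= i in the 1-based a_1 < ... < a_k. *)
Definition gap (s : seq nat) (i : nat) : nat := nth 0 s i - nth 0 s i.-1.

Definition sparse m (A : {set 'I_m}) : bool :=
  (#|A| <= 2) ||
  [forall i : 'I_#|A|, (2 <= i) ==> (gap (elems A) i >= gap (elems A) i.-1)].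

Definition strongly_sparse m (A : {set 'I_m}) : bool :=
  (#|A| <= 2) ||
  [forall i : 'I_#|A|, (2 <= i) ==> (gap (elems A) i > gap (elems A) i.-1)].

(* Subsets of {1, ..., n} are the sets of ordinals in 'I_n.+1 avoiding 0;
   [ord_max] is n. *)
Definition sparse_sets (n l : nat) : {set {set 'I_n.+1}} :=
  [set A : {set 'I_n.+1} |
    [&& ord0 \notin A, ord_max \in A, sparse A & strong_schreier l A]].

Definition strongly_sparse_sets (n l : nat) : {set {set 'I_n.+1}} :=
  [set A : {set 'I_n.+1} |
    [&& ord0 \notin A, ord_max \in A, strongly_sparse A & strong_schreier l A]].

Definition is_partition (n : nat) (s : seq nat) : bool :=
  [&& sorted geq s, all (fun p => 0 < p) s & sumn s == n].

(* A partition of n has at most n parts, all at most n, so partitions of n live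
   in the finite type of sequences of length at most n over 'I_n.+1; by
   [partition_partsP] none is lost. *)
Definition parts n (s : {bseq n of 'I_n.+1}) : seq nat :=
  [seq val p | p <- s].

Lemma parts_inj n : injective (@parts n).
Proof. by move=> s t /(inj_map val_inj)/val_inj. Qed.

Lemma partition_partsP n (s : seq nat) :
  is_partition n s -> exists t : {bseq n of 'I_n.+1}, parts t = s.
Proof.
case/and3P=> _ pos_s /eqP sum_s.
have le_n p : p \in s -> p < n.+1.
  rewrite ltnS -sum_s => s_p; rewrite sumnE (perm_big _ (perm_to_rem s_p)) big_cons.
  exact: leq_addr.
have size_s : size [seq inord p : 'I_n.+1 | p <- s] <= n.
  rewrite size_map -sum_s; elim: s pos_s {sum_s le_n} => //= x s IHs.
  by case/andP=> x_gt0 /IHs le_s; rewrite -add1n leq_add.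
exists (Bseq size_s); rewrite /parts /= -map_comp -[RHS]map_id.
by apply/eq_in_map=> p /le_n lt_p /=; rewrite inordK.
Qed.

Definition partitions_G (n l : nat) : {set {bseq n of 'I_n.+1}} :=
  [set s : {bseq n of 'I_n.+1} |
    is_partition n (parts s) & all (fun p => ~~ (2 <= p <= l)) (parts s)].

Definition partitions_H (n l : nat) : {set {bseq n of 'I_n.+1}} :=
  [set s : {bseq n of 'I_n.+1} |
    [&& is_partition n (parts s),
        all (fun p => ~~ (2 <= p <= l)) (parts s) &
        all (fun p => ~~ (~~ odd p && (2 * l < p))) (parts s)]].

(* Main.v *)
Require Import Defs.
From mathcomp Require Import all_boot zify.

Set Implicit Arguments.
Unset Strict Implicit.
Unset Printing Implicit Defensive.

(** A set [a_1 < ... < a_k = n] is determined by [a_1] and its gaps [d_i].  The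
    Schreier condition says that [r = a_1 - 1 - l (k - 1)] is nonnegative, and
    [n - 1 = r + \sum_i (d_i + l)]; so the gaps shifted by [l], together with
    [r] ones, form a partition of [n - 1] without parts in [2, l].  Sparse sets
    give all these partitions, strongly sparse sets those whose parts greater
    than [l] are distinct.

    The latter are matched with [H] by an Euler-type argument: for
    [j = l + 1, l + 2, ...] in turn, the copies of [j] are merged in pairs into
    copies of [2 j].  Before step [j] the part [j] is unrestricted and [2 j] is
    forbidden; after it [j] occurs at most once and [2 j] is unrestricted. *)

(** * Counting through codes by sequences *)

(** The left inverse [G] makes [F] injective on the codes of [A]. Maps can thus be given on raw
    sequences, and two such inequalities replace a bijection between finite types. *)
Lemma leq_card_coded (T U : finType) (X Y : eqType) (A : {set T}) (B : {set U})
    (e : T -> X) (e' : U -> Y) (F : X -> Y) (G : Y -> X) :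
    injective e -> {in A, forall x, G (F (e x)) = e x} ->
    {in A, forall x, exists2 y, y \in B & e' y = F (e x)} ->
  #|A| <= #|B|.
Proof.
move=> e_inj eK AB.
rewrite cardE -(size_map (F \o e)) [#|B|]cardE -(size_map e').
apply: uniq_leq_size.
  rewrite map_inj_in_uniq ?enum_uniq // => x y; rewrite !mem_enum => Ax Ay /= eqF.
  by apply: e_inj; rewrite -(eK _ Ax) -(eK _ Ay) eqF.
move=> z /mapP[x]; rewrite mem_enum => Ax ->.
have [y By eqy] := AB x Ax.
by apply/mapP; exists y; rewrite ?mem_enum.
Qed.

Lemma geq_trans : transitive geq.
Proof. by move=> x y z /= h1 h2; apply: leq_trans h2 h1. Qed.

#[local] Hint Resolve geq_trans : core.

Lemma elems_inj m : injective (@elems m).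
Proof. by move=> A B eqAB; apply/setP=> a; rewrite -!mem_elems eqAB. Qed.

Lemma elems_surj m (s : seq nat) :
  sorted ltn s -> all (gtn m) s -> exists A : {set 'I_m}, elems A = s.
Proof.
move=> s_sorted /allP lt_s; exists [set i : 'I_m | val i \in s].
apply: (irr_sorted_eq ltn_trans ltnn (sorted_elems _) s_sorted) => x.
apply/idP/idP=> [/mapP[i]|s_x]; first by rewrite mem_enum inE => ? ->.
have lt_x : x < m := lt_s x s_x.
by rewrite -[x]/(val (Ordinal lt_x)) mem_elems inE.
Qed.

Definition card_partitions n (P : pred (seq nat)) : nat :=
  #|[set s : {bseq n of 'I_n.+1} | is_partition n (parts s) & P (parts s)]|.

Lemma eq_card_partitions n (P Q : pred (seq nat)) :
    (forall s, is_partition n s -> P s = Q s) ->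
  card_partitions n P = card_partitions n Q.
Proof.
move=> eqPQ; apply: eq_card => s; rewrite !inE.
by case: (boolP (is_partition _ _)) => //= /eqPQ.
Qed.

Lemma leq_card_partitions n (P Q : pred (seq nat)) (F G : seq nat -> seq nat) :
    (forall s, is_partition n s -> P s ->
      [/\ is_partition n (F s), Q (F s) & G (F s) = s]) ->
  card_partitions n P <= card_partitions n Q.
Proof.
move=> FP; apply: (@leq_card_coded _ _ _ _ _ _ _ (@parts n) F G (@parts_inj n)).
  by move=> s; rewrite inE => /andP[/FP h /h[]].
move=> s; rewrite inE => /andP[/FP h /h[part QF _]].
have [t def_t] := partition_partsP part.
by exists t; rewrite // inE def_t part.
Qed.

(** * Sets and their gaps *)

Definition diff (x y : nat) : nat := y - x.

Definition gaps (s : seq nat) : seq nat :=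
  if s is a :: t then pairmap diff a t else [::].

Lemma size_gaps s : size (gaps s) = (size s).-1.
Proof. by case: s => //= a t; rewrite size_pairmap. Qed.

Lemma path_gaps a t : path ltn a t ->
  [/\ all (leq 1) (pairmap diff a t), scanl addn a (pairmap diff a t) = t
    & last a t = a + sumn (pairmap diff a t)].
Proof.
elim: t a => [|b t IHt] a /=; first by rewrite addn0.
case/andP=> ltab /IHt[-> eqt ->]; rewrite {1 4}/diff.
by rewrite subn_gt0 ltab subnKC ?eqt ?(ltnW ltab) // addnA subnKC // ltnW.
Qed.

Lemma scanl_gaps a d : all (leq 1) d ->
  [/\ path ltn a (scanl addn a d), pairmap diff a (scanl addn a d) = d
    & last a (scanl addn a d) = a + sumn d].
Proof.
elim: d a => [|x d IHd] a /=; first by rewrite addn0.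
case/andP=> x_gt0 /(IHd (a + x))[-> -> ->].
by rewrite /diff addKn addnA andbT; split=> //; lia.
Qed.

Lemma sorted_gapsP (r : rel nat) s :
  reflect (forall i, i < size s -> 2 <= i -> r (gap s i.-1) (gap s i))
          (sorted r (gaps s)).
Proof.
(* [gap s 0] is the junk value 0, so [gaps] starts with the gap of rank 1; this is why the condition
   on ranks starts at 2. *)
have nth_gaps i : i.+1 < size s -> nth 0 (gaps s) i = gap s i.+1.
  by case: s => //= a t lti; rewrite (nth_pairmap 0).
apply: (iffP (sortedP 0)) => [h [|[|i]] // lti _ | h i].
  by rewrite /= -!nth_gaps ?(ltnW lti) //; apply: h; rewrite size_gaps; lia.
rewrite size_gaps => lti; rewrite !nth_gaps; try lia.
by apply: (h i.+2); lia.
Qed.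

Lemma size_elems m (A : {set 'I_m}) : size (elems A) = #|A|.
Proof. by rewrite size_map -cardE. Qed.

(** Taking [leq] or [ltn] for [r] gives the two notions of sparseness. At most two elements leave at
    most one gap, and such a list is sorted. *)
Lemma forall_gapE (r : rel nat) m (A : {set 'I_m}) :
  ((#|A| <= 2) ||
   [forall i : 'I_#|A|, (2 <= i) ==> r (gap (elems A) i.-1) (gap (elems A) i)])
  = sorted r (gaps (elems A)).
Proof.
rewrite -size_elems.
apply/idP/sorted_gapsP => [/orP[le2 i|/forallP h i lti le2i]|h].
- by lia.
- by have /implyP := h (Ordinal lti); apply.
by apply/orP; right; apply/forallP=> i; apply/implyP; apply: h.
Qed.

Definition schreier_seq n l (r : rel nat) : pred (seq nat) :=
  fun s => [&& sorted ltn s, last 0 s == n, sorted r (gaps s)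
             & l * (size s).-1 < head 0 s].

Definition schreier_sets n l (r : rel nat) : {set {set 'I_n.+1}} :=
  [set A : {set 'I_n.+1} |
    [&& ord0 \notin A, ord_max \in A, sorted r (gaps (elems A))
      & strong_schreier l A]].

Lemma mem_schreier_sets n l r (A : {set 'I_n.+1}) : 0 < n ->
  (A \in schreier_sets n l r) = schreier_seq n l r (elems A).
Proof.
move=> n_gt0; rewrite inE -!mem_elems /strong_schreier /set_min -size_elems.
have -> : (A == set0) = (elems A == [::]).
  by rewrite -size_eq0 size_elems cards_eq0.
have lt_n : all (gtn n.+1) (elems A) by apply/allP=> _ /mapP[i _ ->] /=.
rewrite /schreier_seq; have := sorted_elems A => /[dup] srt -> /=.
(* The empty set fails on both sides: it lacks [n], and its default last entry 0 differs from
   [n > 0]. *)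
case: (elems A) srt lt_n => [|a t] /=; first by rewrite eq_sym eqn0Ngt n_gt0.
move=> path_t /andP[lt_a lt_t].
have -> : l * (size t).+1 - l + 1 = (l * size t).+1 by rewrite mulnS addKn addn1.
have -> : (n \in a :: t) = (last a t == n).
  apply/idP/eqP=> [n_in | <-]; last exact: mem_last.
  have : last a t \in a :: t := mem_last a t.
  have le_last : {in a :: t, forall x, x <= last a t}.
    elim: t a path_t {lt_a lt_t n_in} => [|b t IHt] a /=.
      by move=> _ x; rewrite inE => /eqP->.
    case/andP=> ltab /IHt h x; rewrite inE => /predU1P[->|]; last exact: h.
    by apply: leq_trans (h b _); rewrite ?(ltnW ltab) ?mem_head.
  move: (le_last n n_in) => le_n /(allP (_ : all (gtn n.+1) (a :: t))) /=.
  rewrite lt_a lt_t => /(_ isT); lia.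
(* A first entry 0 violates both [ord0 \notin A] and the strict Schreier bound. *)
case: (posnP a) => [a0|a_gt0]; first by rewrite a0 mem_head ltn0 !andbF.
suff -> : 0 \notin a :: t by [].
rewrite inE negb_or neq_ltn a_gt0 /=; apply/negP=> t0.
by move: path_t; rewrite path_sortedE; [case/andP=> /allP/(_ 0 t0)|exact: ltn_trans].
Qed.

(** * Sets as partitions without parts in [2, l] *)

Section GapPartitions.

Variable l : nat.
Hypothesis l_gt0 : 0 < l.
Variable r : rel nat.
Hypothesis r_leq : subrel r leq.
Hypothesis r_shift : forall x y, r (x + l) (y + l) = r x y.

(** Gaps increase along a sparse set while parts are listed in nonincreasing order, hence the
    reversal. *)
Definition gap_partition (s : seq nat) : seq nat :=
  rev [seq d + l | d <- gaps s] ++ nseq (head 0 s - (l * (size s).-1).+1) 1.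

Definition partition_gaps (s : seq nat) : seq nat :=
  [seq p - l | p <- rev [seq p <- s | l < p]].

Definition partition_seq (s : seq nat) : seq nat :=
  let d := partition_gaps s in
  let a := (count_mem 1 s + l * size d).+1 in a :: scanl addn a d.

(** On partitions the second condition is automatic for [leq], and for [ltn] says that the parts
    above [l] are distinct. *)
Definition gap_partition_pred : pred (seq nat) :=
  fun s => all (fun p => ~~ (2 <= p <= l)) s
           && sorted r (rev [seq p <- s | l < p]).

(** A positive part that is at most [l] and outside [2, l] is 1, and the ordering puts the large
    parts first. *)
Lemma partition_split s n : is_partition n s ->
    all (fun p => ~~ (2 <= p <= l)) s ->
  s = [seq p <- s | l < p] ++ nseq (count_mem 1 s) 1.
Proof.
case/and3P=> srt pos _ no2l.
have fE : [seq p <- s | ~~ (l < p)] = nseq (count_mem 1 s) 1.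
  elim: s pos no2l {srt} => //= x s IHs /andP[x_gt0 /IHs h] /andP[x2l /h {h} ->].
  by case: (ltnP l x) => lx; case: (x =P 1) => x1 //=; rewrite ?x1 //; lia.
rewrite -fE; apply: (sorted_eq geq_trans) => //.
- by move=> x y /=; lia.
- elim: s srt {pos no2l fE} => //= x s IHs xs.
  have {}IHs := IHs (path_sorted xs).
  move: xs; rewrite path_sortedE // => /andP[/allP le_x srt].
  case: (ltnP l x) => lx /=.
    rewrite path_sortedE // IHs andbT; apply/allP=> y.
    by rewrite mem_cat !mem_filter => /orP[]/andP[_ /le_x].
  have -> : [seq p <- s | l < p] = [::].
    by apply/eqP; rewrite -[_ == _]negbK -has_filter; apply/hasPn=> y /le_x /=; lia.
  rewrite /= path_sortedE // sorted_filter // andbT; apply/allP=> y.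
  by rewrite mem_filter => /andP[_ /le_x].
by rewrite perm_sym perm_filterC.
Qed.

Lemma sumn_shift d : sumn [seq x + l | x <- d] = sumn d + l * size d.
Proof. by elim: d => /= [|x d ->]; rewrite ?muln0 // mulnS; lia. Qed.

Lemma sorted_shift d : sorted r [seq x + l | x <- d] = sorted r d.
Proof. by rewrite sorted_map; apply: eq_sorted => x y /=; exact: r_shift. Qed.

Lemma filter_gap_partition d c : all (leq 1) d ->
  [seq p <- rev [seq x + l | x <- d] ++ nseq c 1 | l < p]
  = rev [seq x + l | x <- d].
Proof.
move=> pos; rewrite filter_cat [X in _ ++ X](_ : _ = [::]).
  rewrite cats0; apply/all_filterP; rewrite all_rev all_map.
  by apply: sub_all pos => x /=; lia.
by elim: c => //= c ->; rewrite ltnNge l_gt0.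
Qed.

Lemma count1_gap_partition d c : all (leq 1) d ->
  count_mem 1 (rev [seq x + l | x <- d] ++ nseq c 1) = c.
Proof.
move=> pos; rewrite count_cat count_nseq mul1n.
rewrite (_ : count_mem 1 _ = 0) //; apply/count_memPn.
rewrite mem_rev; apply/mapP=> -[x /(allP pos)]; lia.
Qed.

Lemma gap_partitionP n s : schreier_seq n.+1 l r s ->
  [/\ is_partition n (gap_partition s), gap_partition_pred (gap_partition s)
    & partition_seq (gap_partition s) = s].
Proof.
case/and4P; case: s => [|a t] //= path_t /eqP last_t r_gaps lt_a.
have [pos scanK last_sum] := path_gaps path_t.
rewrite /gap_partition /gap_partition_pred /partition_seq /partition_gaps /=.
rewrite filter_gap_partition // count1_gap_partition // revK sorted_shift.
have size_d : size (pairmap diff a t) = size t by rewrite size_pairmap.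
move: r_gaps pos scanK last_sum size_d.
move: (pairmap diff a t) => d r_gaps pos scanK last_sum size_d.
have no2l : all (fun p => ~~ (2 <= p <= l))
    (rev [seq x + l | x <- d] ++ nseq (a - (l * size t).+1) 1).
  rewrite all_cat all_rev all_map; apply/andP; split.
    by apply: sub_all pos => x /=; lia.
  by apply/allP=> x /nseqP[->].
split; last first.
- rewrite -map_comp (@eq_map _ _ _ id) => [|x]; last by rewrite /= addnK.
  rewrite map_id size_d; have -> : (a - (l * size t).+1 + l * size t).+1 = a by lia.
  by rewrite scanK.
- by rewrite no2l.
apply/and3P; split.
- rewrite (sorted_pairwise geq_trans) pairwise_cat -!(sorted_pairwise geq_trans).
  apply/and3P; split.
  + apply/allrelP=> x y; rewrite mem_rev => /mapP[z /(allP pos) z_gt0 ->].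
    by case/nseqP=> -> _ /=; lia.
  + rewrite rev_sorted; have := r_gaps; rewrite -sorted_shift.
    by apply: sub_sorted => x y /r_leq.
  by elim: (a - _) => //= c IHc; rewrite path_sortedE // IHc andbT; apply/allP=> x /nseqP[->].
- rewrite all_cat all_rev all_map; apply/andP; split; last by apply/allP=> x /nseqP[->].
  by apply: sub_all pos => x /=; lia.
(* The last entry gives [a + sumn d = n.+1]; by [lt_a] the truncated number of ones is the exact
   difference. *)
rewrite sumn_cat sumn_rev sumn_shift sumn_nseq size_d; lia.
Qed.

Lemma partition_seqP n s : is_partition n s -> gap_partition_pred s ->
  schreier_seq n.+1 l r (partition_seq s) /\ gap_partition (partition_seq s) = s.
Proof.
move=> part_s /andP[no2l r_s].
have s_split := partition_split part_s no2l.
have shiftK : [seq d + l | d <- partition_gaps s] = rev [seq p <- s | l < p].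
  rewrite /partition_gaps -map_comp -[RHS]map_id; apply/eq_in_map=> p.
  by rewrite mem_rev mem_filter => /andP[lp _] /=; rewrite subnK // ltnW.
have pos : all (leq 1) (partition_gaps s).
  apply/allP=> _ /mapP[p + ->]; rewrite mem_rev mem_filter => /andP[lp _]; lia.
rewrite /schreier_seq /gap_partition /partition_seq /=.
set a := (count_mem 1 s + _).+1.
have [-> -> ->] := scanl_gaps a pos.
rewrite size_scanl shiftK revK; split.
  have := r_s; rewrite -shiftK sorted_shift => -> /=.
  apply/andP; split; last by rewrite /a; lia.
  case/and3P: part_s => _ _ /eqP <-; rewrite {2}s_split sumn_cat sumn_nseq.
  rewrite -(sumn_rev [seq p <- s | l < p]) -shiftK sumn_shift /a; lia.
by rewrite /a subSS addnK -s_split.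
Qed.

Lemma card_schreier_sets n :
  #|schreier_sets n.+1 l r| = card_partitions n gap_partition_pred.
Proof.
apply/eqP; rewrite eqn_leq; apply/andP; split.
  apply: (@leq_card_coded _ _ _ _ _ _ _ (@parts n) gap_partition partition_seq
    (@elems_inj _)) => A; rewrite mem_schreier_sets // => /gap_partitionP[part pr K] //.
  have [t def_t] := partition_partsP part.
  by exists t; rewrite // inE def_t part.
apply: (@leq_card_coded _ _ _ _ _ _ _ (@elems n.+2) partition_seq gap_partition
  (@parts_inj n)) => s; rewrite inE => /andP[part pr];
  have [sch K] := partition_seqP part pr => //.
have [] := @elems_surj n.+2 (partition_seq (parts s)).
- by case/and4P: sch.
- case/and4P: sch; case: (partition_seq _) => //= a t path_t /eqP <- _ _.
  (* The entries increase to the last one, [n.+1], so they all lie below [n.+2]. *)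
  elim: t a path_t => [|b t IHt] a /=; first by rewrite leqnn.
  by case/andP=> ltab /IHt /andP[ltb ->]; rewrite ltb (leq_trans ltab (ltnW ltb)).
by move=> A def_A; exists A; rewrite ?mem_schreier_sets ?def_A.
Qed.

End GapPartitions.

(** * Merging equal parts in pairs *)

Section Merge.

Variable j : nat.
Hypothesis j_gt0 : 0 < j.

Definition other_parts (s : seq nat) : seq nat :=
  [seq p <- s | (p != j) && (p != j.*2)].

Definition with_counts (s : seq nat) (c c' : nat) : seq nat :=
  sort geq (nseq c j ++ nseq c' j.*2 ++ other_parts s).

(** Copies of [j.*2] already in [s] are overwritten, so the sum is kept only when there are none. *)
Definition merge_pairs (s : seq nat) : seq nat :=
  with_counts s (odd (count_mem j s)) (count_mem j s)./2.

Definition split_pairs (s : seq nat) : seq nat :=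
  with_counts s (count_mem j s + (count_mem j.*2 s).*2) 0.

Lemma count_with_counts s c c' i :
  count_mem i (with_counts s c c') =
  if i == j then c else if i == j.*2 then c' else count_mem i s.
Proof.
have neq_j : (j == j.*2) = false by apply/eqP; lia.
rewrite (permP (permEl (perm_sort _ _))) !count_cat !count_nseq /= count_filter.
rewrite (eq_sym j) (eq_sym j.*2).
have [->|ij] := eqVneq i j.
  rewrite neq_j mul1n (eq_count (a2 := pred0)) ?count_pred0 ?addn0 // => x /=.
  by case: eqP.
have [->|i2j] := eqVneq i j.*2.
  rewrite mul1n (eq_count (a2 := pred0)) ?count_pred0 ?addn0 // => x /=.
  by case: (x =P j.*2) => // _; rewrite /= andbF.
by apply: eq_count => x /=; case: eqP => // ->; rewrite ij i2j.
Qed.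

Lemma sorted_with_counts s c c' : sorted geq (with_counts s c c').
Proof. by apply: sort_sorted => x y; rewrite /= leq_total. Qed.

(** Reduces equalities between partitions to multiplicities, which [count_with_counts] computes. *)
Lemma sorted_geq_eq s t : sorted geq s -> sorted geq t ->
  (forall i, count_mem i s = count_mem i t) -> s = t.
Proof.
move=> srts srtt eqc; apply: (sorted_eq geq_trans _ srts srtt) => [x y /=|].
- by lia.
by apply/allP=> i _; rewrite /= eqc.
Qed.

Lemma is_partition_with_counts n s c c' : is_partition n s ->
    c + c'.*2 = count_mem j s + (count_mem j.*2 s).*2 ->
  is_partition n (with_counts s c c').
Proof.
case/and3P=> srt pos /eqP <- eqc.
have sum_wc b b' : sumn (with_counts s b b') = (b + b'.*2) * j + sumn (other_parts s).
  by rewrite (perm_sumn (permEl (perm_sort _ _))) !sumn_cat !sumn_nseq; lia.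
apply/and3P; split; first exact: sorted_with_counts.
  rewrite all_sort !all_cat all_filter; apply/and3P; split.
  - by apply/allP=> x /nseqP[->].
  - by apply/allP=> x /nseqP[-> _]; rewrite double_gt0.
  by apply: sub_all pos => x /= ->; rewrite implybT.
(* Rebuilding [s] from its own multiplicities lets [sum_wc] evaluate both sums. *)
rewrite [in X in _ == X](_ : s = with_counts s (count_mem j s) (count_mem j.*2 s)).
  by rewrite !sum_wc eqc.
apply: sorted_geq_eq => // [|i]; first exact: sorted_with_counts.
by rewrite count_with_counts; case: eqP => [->|_] //; case: eqP => [->|].
Qed.

Lemma merge_pairsK s : sorted geq s -> count_mem j.*2 s = 0 ->
  split_pairs (merge_pairs s) = s.
Proof.
move=> srt c0; apply: sorted_geq_eq => // [|i]; first exact: sorted_with_counts.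
rewrite !count_with_counts !eqxx (_ : (j.*2 == j) = false); last by apply/eqP; lia.
by rewrite odd_double_half; case: eqP => [->|_] //; case: eqP => [->|].
Qed.

(** If [c <= 1], then [c] and [c'] are recovered from [c + c'.*2] as its parity and its half. *)
Lemma split_pairsK s : sorted geq s -> count_mem j s <= 1 ->
  merge_pairs (split_pairs s) = s.
Proof.
move=> srt c1; apply: sorted_geq_eq => // [|i]; first exact: sorted_with_counts.
rewrite !count_with_counts !eqxx.
by case: eqP => [->|_]; [|case: eqP => [->|//]]; lia.
Qed.

End Merge.

(** * From bounded even parts to distinct large parts *)

Section EulerType.

Variable l : nat.

(** The state once all [j <= t] have been merged. For partitions of [n], [t = l] gives H, and any
    [t >= n] with [t >= l] gives those whose parts above [l] are distinct. *)
Definition euler_stage (t : nat) : pred (seq nat) :=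
  fun s => all (fun p => [&& ~~ (2 <= p <= l), (l < p <= t) ==> (count_mem p s <= 1)
                           & ~~ [&& ~~ odd p, 2 * l < p & 2 * t < p]]) s.

Lemma euler_stageP t s :
  reflect (forall p, 0 < count_mem p s ->
             [/\ ~~ (2 <= p <= l), l < p <= t -> count_mem p s <= 1
               & ~~ odd p -> 2 * l < p -> p <= 2 * t])
          (euler_stage t s).
Proof.
have memE p : (p \in s) = (0 < count_mem p s) by rewrite -has_pred1 has_count.
apply: (iffP allP) => h p; [rewrite -memE | rewrite memE] => /h.
  by case/and3P=> -> /implyP h2 h3; split => // ? ?; lia.
by case=> -> h2 h3; rewrite /=; apply/andP; split; [apply/implyP | lia].
Qed.

Hypothesis l_gt0 : 0 < l.

Lemma card_euler_stageS t n : l <= t ->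
  card_partitions n (euler_stage t) = card_partitions n (euler_stage t.+1).
Proof.
move=> le_lt; apply/eqP; rewrite eqn_leq; apply/andP; split.
  apply: (@leq_card_partitions _ _ _ (merge_pairs t.+1) (split_pairs t.+1)).
  move=> s part /euler_stageP h.
  (* The part [2 * t.+1] is even and exceeds both [2 * l] and [2 * t], so stage [t] forbids it. *)
  have c0 : count_mem t.+1.*2 s = 0.
    apply/eqP; rewrite -leqn0 leqNgt; apply/negP=> /h[_ _]; lia.
  split; last by apply: merge_pairsK => //; case/and3P: part.
  - by apply: is_partition_with_counts => //; rewrite c0; lia.
  apply/euler_stageP=> p; rewrite count_with_counts //.
  case: eqP => [->|pj]; first by split; lia.
  (* The new part [2 * t.+1] exceeds [t.+1], so stage [t.+1] leaves its multiplicity free. *)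
  case: eqP => [->|p2j]; first by split; lia.
  by case/h=> h1 h2 h3; split => //; lia.
apply: (@leq_card_partitions _ _ _ (split_pairs t.+1) (merge_pairs t.+1)).
move=> s part /euler_stageP h.
have c1 : count_mem t.+1 s <= 1.
  by case: (posnP (count_mem t.+1 s)) => [->//|/h[_ h2 _]]; apply: h2; lia.
split; last by apply: split_pairsK => //; case/and3P: part.
- by apply: is_partition_with_counts => //; lia.
apply/euler_stageP=> p; rewrite count_with_counts //.
case: eqP => [->|pj]; first by split; lia.
case: eqP => [->|p2j]; first by [].
(* An even [p <= 2 * t.+1] other than [2 * t.+1] is at most [2 * t]. *)
by case/h=> h1 h2 h3; split => //; lia.
Qed.

Lemma card_euler_stage t n : l <= t ->
  card_partitions n (euler_stage l) = card_partitions n (euler_stage t).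
Proof.
move/subnKC <-; elim: (t - l) => [|k IHk]; first by rewrite addn0.
by rewrite IHk addnS card_euler_stageS ?leq_addr.
Qed.

End EulerType.

(** * The final stage and the two counts *)

Lemma leq_sumn_mem (s : seq nat) p : p \in s -> p <= sumn s.
Proof.
by move=> s_p; rewrite (perm_sumn (perm_to_rem s_p)) /= leq_addr.
Qed.

(** All parts are at most [n <= l + n]: distinctness thus reaches every part above [l], and every
    even part meets its bound. *)
Lemma gap_partition_pred_ltnE l n s : is_partition n s ->
  gap_partition_pred l ltn s = euler_stage l (l + n) s.
Proof.
case/and3P=> srt _ /eqP sum_s.
have memE p : (p \in s) = (0 < count_mem p s) by rewrite -has_pred1 has_count.
have le_n p : 0 < count_mem p s -> p <= n.
  by rewrite -memE -sum_s; exact: leq_sumn_mem.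
have srt_f : sorted leq (rev [seq p <- s | l < p]).
  by rewrite rev_sorted; apply: sorted_filter.
(* Strictly increasing means weakly increasing and duplicate-free; the former holds for any
   partition. *)
rewrite /gap_partition_pred ltn_sorted_uniq_leq srt_f andbT rev_uniq.
apply/andP/euler_stageP => [[no2l uniq_f] p p_s|h].
  split=> [||_ _]; first by apply: (allP no2l); rewrite memE.
    case/andP=> lp _; have := count_uniq_mem p uniq_f.
    rewrite count_filter (eq_count (a2 := pred1 p)) => [->|x /=]; first by case: (_ \in _).
    by case: eqP => // ->.
  by have := le_n p p_s; lia.
split; first by apply/allP=> p; rewrite memE => /h[].
apply: count_mem_uniq => p; rewrite mem_filter count_filter memE.
case: (ltnP l p) => lp /=; last first.
  by rewrite (eq_count (a2 := pred0)) ?count_pred0 // => x /=; case: eqP => // ->; lia.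
rewrite (eq_count (a2 := pred1 p)) => [|x /=]; last by case: eqP => // ->.
case: (posnP (count_mem p s)) => [->//|c_gt0].
by have [_ h2 _] := h p c_gt0; have := le_n p c_gt0; lia.
Qed.

Theorem theorem1p7 (n l : nat) (hn : 1 <= n) (hl : 1 <= l) :
  #|sparse_sets n l| = #|partitions_G (n - 1) l| /\
  #|strongly_sparse_sets n l| = #|partitions_H (n - 1) l|.
Proof.
case: n hn => // n _; rewrite subSS subn0.
split.
  transitivity #|schreier_sets n.+1 l leq|.
    by apply: eq_card => A; rewrite !inE -forall_gapE.
  rewrite card_schreier_sets //; last by move=> x y; rewrite leq_add2r.
  apply: eq_card_partitions => s /and3P[srt _ _].
  by rewrite /gap_partition_pred rev_sorted sorted_filter ?andbT.
transitivity #|schreier_sets n.+1 l ltn|.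
  by apply: eq_card => A; rewrite !inE -forall_gapE.
rewrite card_schreier_sets //; first last.
- by move=> x y; rewrite /= ltn_add2r.
- by move=> x y /ltnW.
rewrite (eq_card_partitions (@gap_partition_pred_ltnE l n)).
rewrite -card_euler_stage ?leq_addr //.
apply: (@eq_card_partitions _ _ (fun s => all (fun p => ~~ (2 <= p <= l)) s
  && all (fun p => ~~ (~~ odd p && (2 * l < p))) s)) => s _.
(* At stage [l] the range [l < p <= l] is empty and both bounds on even parts are [2 * l], which
   leaves H. *)
rewrite -all_predI; apply: eq_all => p /=.
by congr (_ && _); case: (odd p) => /=; lia.
Qed.
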